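(* Consider the closed chain of $N$ contours with $2m$ cells and a cluster of $l<2m$ particles on each contour (dynamics in the context). 1) If $N$ is odd and $l\le \frac{m}{N}$, or $N$ is even and $l\le\frac{2m}{N}$, then the system results in a state of free movement from any admissible initial state. 2) If $N$ is odd and $\frac{m}{N}<l\le m$, or $N$ is even and $\frac{2m}{N}<l\le m$, then there exist limit cycles with average velocity of clusters equal to $1$, and there may also exist limit cycles with average velocity less than $1$; the number of distinct values less than $1$ of the average velocity (over all limit cycles) is at most $\lfloor N/3\rfloor$. Every such value is of the form $$v=\frac{2mr}{N(m+l)},$$ where $r$ is an integer such that $2/3\le v<1$. For an integer $r$ such that $2/3\le \frac{2mr}{N(m+l)}<1$, there exists a limit cycle with average velocity $\frac{2mr}{N(m+l)}$ if and only if there exist integers $k_1,\dots,k_r$ with $0\le k_j\le l$ $(j=1,\dots,r)$ satisfying $$(m+l)N=2mr+k_1+\dots+k_r .$$ 3) If $l>m$, then the system results in a state of collapse from any admissible initial state.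
   Context: Closed chain of contours. Integers $N\ge 2$, $m\ge 1$, $1\le l<2m$. Contours are indexed by $i\in\mathbb{Z}/N$ (arithmetic of contour indices is modulo $N$); each contour has $2m$ cells indexed $0,1,\dots,2m-1$ in the direction of movement (arithmetic of cells is modulo $2m$) and one cluster of $l$ particles in consecutive cells. The state $x_i(t)\in\{0,\dots,2m-1\}$ of contour $i$ at time $t$ is the cell of the leading particle of its cluster (cluster $i$); the system state is $(x_0(t),\dots,x_{N-1}(t))$. Contours $i$ and $i+1$ share the node $(i,i+1)$, located between cells $0,1$ of contour $i$ and between cells $m,m+1$ of contour $i+1$. Cluster $i$ occupies node $(i,i+1)$ if $x_i\in\{1,\dots,l-1\}$; cluster $i$ occupies node $(i-1,i)$ if $x_i\in\{m+1,\dots,m+l-1\}$ modulo $2m$. A state is admissible if no node is occupied by two clusters; only admissible states are considered. Dynamics ($t\to t+1$, all clusters simultaneously): $x_i(t+1)=x_i(t)+1 \bmod 2m$ unless cluster $i$ is delayed at time $t$, in which case $x_i(t+1)=x_i(t)$. Cluster $i$ is delayed at time $t$ iff either $x_i(t)=0$ and cluster $i+1$ occupies node $(i,i+1)$; or $x_i(t)=m$ and cluster $i-1$ occupies node $(i-1,i)$; or $x_i(t)=m$ and $x_{i-1}(t)=0$ (left-priority rule). The system is deterministic with finitely many states, so every trajectory is eventually periodic; the resulting periodic sequence of states is called a limit cycle. The average velocity of cluster $i$ is $v_i=\lim_{t\to\infty}S_i(t)/t$, where $S_i(t)$ is the number of moves of cluster $i$ in the time interval $(0,t)$; it depends only on the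 limit cycle reached. In each limit cycle all clusters have the same average velocity $v$, called the average velocity of the limit cycle. The system is in a state of free movement (resp. collapse) at time $t_0$ if at every time $t\ge t_0$ every cluster moves (resp. no cluster moves); ''results in'' means reaches such a state at some finite time. *)

(* Defs.v *)
From mathcomp Require Import all_boot all_order all_algebra.
From mathcomp Require Import all_classical all_reals all_analysis.
Import Order.TTheory GRing.Theory Num.Theory.
Import numFieldNormedType.Exports.

Set Implicit Arguments.
Unset Strict Implicit.
Unset Printing Implicit Defensive.

(* [ordS] and [ord_pred] are the cyclic successor and predecessor on 'I_n, so
   they implement the arithmetic modulo N on contours and modulo 2m on cells.
   The node (i, i+1) is the "right" node of contour i (between its cells 0 and
   1) and the "left" node of contour i+1 (between its cells m and m+1). For
   N = 2 the nodes (0, 1) and (1, 0) are different. *)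

Definition state (N m : nat) := {ffun 'I_N -> 'I_(2 * m)}.

Definition occupies_right (m l : nat) (c : 'I_(2 * m)) : bool := 0 < c < l.

Definition occupies_left (m l : nat) (c : 'I_(2 * m)) : bool :=
  [exists k : 'I_l, (0 < k) && (c == (m + k) %% (2 * m) :> nat)].

Definition admissible (N m l : nat) (x : state N m) : bool :=
  [forall i : 'I_N,
     ~~ (occupies_right l (x i) && occupies_left l (x (ordS i)))].

Definition delayed (N m l : nat) (x : state N m) (i : 'I_N) : bool :=
  [|| (x i == 0 :> nat) && occupies_left l (x (ordS i)),
      (x i == m :> nat) && occupies_right l (x (ord_pred i))
    | (x i == m :> nat) && (x (ord_pred i) == 0 :> nat)].

Definition step (N m l : nat) (x : state N m) : state N m :=
  [ffun i => if delayed l x i then x i else ordS (x i)].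

Definition trajectory (N m l : nat) (x : state N m) (t : nat) : state N m :=
  iter t (step l) x.

Definition moves (N m l : nat) (x : state N m) (i : 'I_N) (t : nat) : nat :=
  \sum_(k < t) ~~ delayed l (trajectory l x k) i.

Definition average_velocity (R : realType) (N m l : nat) (x : state N m)
    (i : 'I_N) (v : R) : Prop :=
  (((moves l x i t)%:R / t%:R : R)%R @[t --> \oo] --> v)%classic.

(* A limit cycle is listed over one period, starting from any of its states:
   [ufcycle] says that each state is followed by its successor, the last one by
   the first one, without repetition. *)
Definition limit_cycle (N m l : nat) (c : seq (state N m)) : Prop :=
  [/\ c != [::], ufcycle (step l) c
    & exists2 x : state N m, admissible l x & exists t, trajectory l x t \in c].

Definition cycle_velocity (R : realType) (N m l : nat) (c : seq (state N m))
    (v : R) : Prop :=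
  {in c, forall x i, average_velocity l x i v}.

Definition limit_velocity (R : realType) (N m l : nat) (v : R) : Prop :=
  exists2 c : seq (state N m), limit_cycle l c & cycle_velocity l c v.

Definition free_movement (N m l : nat) (x : state N m) : Prop :=
  forall t i, ~~ delayed l (trajectory l x t) i.

Definition collapse (N m l : nat) (x : state N m) : Prop :=
  forall t i, delayed l (trajectory l x t) i.

Definition results_in (N m l : nat) (P : state N m -> Prop) (x : state N m) :
    Prop :=
  exists t0, P (trajectory l x t0).

Definition parameters (N m l : nat) : Prop :=
  [/\ 2 <= N, 1 <= m & 1 <= l < 2 * m].

Definition small_cluster (R : realType) (N m l : nat) : Prop :=
  (odd N /\ ((l%:R : R) <= m%:R / N%:R)%R) \/
  (~~ odd N /\ ((l%:R : R) <= (2 * m)%N%:R / N%:R)%R).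

Definition medium_cluster (R : realType) (N m l : nat) : Prop :=
  (odd N /\ (m%:R / N%:R < (l%:R : R) <= m%:R)%R) \/
  (~~ odd N /\ ((2 * m)%N%:R / N%:R < (l%:R : R) <= m%:R)%R).

(* The multiplier r is an integer; the constraint 2/3 <= v < 1 forces it to be
   positive, so it is taken in nat. *)
Definition velocity_value (R : realType) (N m l r : nat) : R :=
  ((2 * m * r)%N%:R / (N * (m + l))%N%:R)%R.

Definition velocity_range (R : realType) (v : R) : Prop :=
  (2%:R / 3%:R <= v < 1)%R.

(* Main.v *)
Require Import Defs.
From mathcomp Require Import all_boot all_order all_algebra.
From mathcomp Require Import all_classical all_reals all_analysis.
From mathcomp Require Import zify ring.
Import Order.TTheory GRing.Theory Num.Theory.
Import numFieldNormedType.Exports.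

Set Implicit Arguments.
Unset Strict Implicit.
Unset Printing Implicit Defensive.

(* For l <= m, attach to the node (i, i+1) the phase u = x_(i+1) - x_i - m
   modulo 2m. If the clusters met at this node undisturbed, cluster i would
   wait there l - u steps when 0 < u < l, and cluster i+1 would wait l - |u|
   steps when -l < u <= 0. The total of these virtual waits never increases, so
   it is eventually constant, and from then on the two kinds of waits are
   transported exactly: waits at right nodes travel towards smaller indices and
   waits at left nodes towards larger ones. Two waits of different kinds would
   have to cross, which is impossible; hence eventually either no cluster is
   ever delayed, or all delays are of one kind. In the latter case every cluster
   repeats the motion of its neighbour with a time lag of m + l, so the motion
   has period N (m + l), during which each cluster makes r laps of length between
   2m and 2m + l. Conversely, a travelling wave with r laps per period exists
   whenever these bounds allow it. For l > m every cluster occupies one of its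
   nodes, and admissibility forces all of them to occupy the same side. *)

Ltac split_if := repeat match goal with
  | |- context [if ?c then _ else _] =>
    lazymatch c with
    | context [if _ then _ else _] => fail
    | _ => case: (boolP c) => ?
    end
  end.

(** * Phases and waits at a single node *)

Definition advance (m : nat) (held : bool) (a : nat) : nat :=
  if held then a else if a.+1 == 2 * m then 0 else a.+1.

(* [b - a - m] modulo [2 * m]. *)
Definition phase (m a b : nat) : nat :=
  if a + m <= b then b - (a + m)
  else if a <= b + m then b + m - a else b + 3 * m - a.

(* The phase -k is represented by [2 * m - k], and truncated subtraction makes
   each wait 0 outside its range. *)
Definition right_wait (l u : nat) : nat := if u == 0 then 0 else l - u.

Definition left_wait (m l u : nat) : nat := if u == 0 then l else u + l - 2 * m.

Definition held_right (m l a b : nat) : bool := (a == 0) && (m < b < m + l).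

(** The bound [a < l] includes [a = 0], which is the left-priority rule. *)
Definition held_left (m l a b : nat) : bool := (b == m) && (a < l).

Lemma phase_advance m a b ha hb : 0 < m -> a < 2 * m -> b < 2 * m ->
  phase m (advance m ha a) (advance m hb b) =
    if ha == hb then phase m a b
    else if ha then advance m false (phase m a b)
    else if phase m a b == 0 then (2 * m).-1 else (phase m a b).-1.
Proof.
by move=> m0 am bm; rewrite /phase /advance; case: ha; case: hb => /=; split_if; lia.
Qed.

Lemma phase_lt m a b : 0 < m -> a < 2 * m -> b < 2 * m -> phase m a b < 2 * m.
Proof. by move=> *; rewrite /phase; split_if; lia. Qed.

(** The flags [la] and [rb] are the delays of the two clusters at their other nodes. A delay at this
    node consumes a unit of wait, and a delay elsewhere creates at most one. The second claim is
    only an inequality because a delay [rb] at phase 1 turns a right wait [l - 1] into a left wait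
    [l]. *)
Lemma node_step m l a b (la rb : bool) :
    0 < m -> 0 < l -> l <= m -> a < 2 * m -> b < 2 * m ->
    (la -> a = m) -> (rb -> b = 0) ->
  let u := phase m a b in
  let ra := held_right m l a b in
  let lb := held_left m l a b in
  let u' := phase m (advance m (ra || la) a) (advance m (rb || lb) b) in
  [/\ right_wait l u' + left_wait m l u' + ra + lb
        <= right_wait l u + left_wait m l u + la + rb,
      right_wait l u' + left_wait m l u' + ra + lb
        = right_wait l u + left_wait m l u + la + rb ->
        left_wait m l u + la <= left_wait m l u' + lb
    & right_wait l u' + left_wait m l u' + ra + lb
        = right_wait l u + left_wait m l u + la + rb ->
      left_wait m l u + la = left_wait m l u' + lb ->
      0 < right_wait l u -> la = false /\ ra = (a == 0)].
Proof.
move=> m0 l0 lm am bm Hla Hrb u ra lb u'.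
have Du' : u' = if (ra || la) == (rb || lb) then u
    else if ra || la then advance m false u
    else if u == 0 then (2 * m).-1 else u.-1 by exact: phase_advance.
have Hra : ra = (a == 0) && (0 < u < l).
  rewrite /ra /held_right /u; case: (a =P 0) => //= ->.
  by rewrite /phase; split_if; lia.
have Hlb : lb -> (u == 0) || (2 * m < u + l).
  by rewrite /lb /held_left /u => /andP[/eqP -> ltl]; rewrite /phase; split_if; lia.
have um : u < 2 * m by exact: phase_lt.
have ra_only : ra -> [/\ la = false, rb = false & lb = false].
  move=> /andP[/eqP a0 bP]; split; first by apply/negP => /Hla; lia.
    by apply/negP => /Hrb; lia.
  by rewrite /lb /held_left; lia.
have lb_only : lb -> la = false /\ rb = false.
  move=> /andP[/eqP bE ltl]; split; first by apply/negP => /Hla; lia.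
  by apply/negP => /Hrb; lia.
have raE : 0 < right_wait l u -> ra = (a == 0).
  by rewrite Hra /right_wait; split_if; lia.
have raP : ra -> 0 < u < l by rewrite Hra => /andP[].
suff [? ? H] : [/\ right_wait l u' + left_wait m l u' + ra + lb
        <= right_wait l u + left_wait m l u + la + rb,
      right_wait l u' + left_wait m l u' + ra + lb
        = right_wait l u + left_wait m l u + la + rb ->
        left_wait m l u + la <= left_wait m l u' + lb
    & right_wait l u' + left_wait m l u' + ra + lb
        = right_wait l u + left_wait m l u + la + rb ->
      0 < right_wait l u -> la = false].
  by split=> // /H + _ u0 => /(_ u0) ->; split=> //; exact: raE.
(* The positions now matter only through the phase and the four delay flags, so they are generalized
   away. *)
move: um ra_only lb_only raP Hlb Du' {Hra raE Hla Hrb am bm}.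
clearbody u ra lb u'; rewrite /right_wait /left_wait /advance => um.
case: ra => [/(_ isT)[-> -> ->] _ /(_ isT) uP _ | _].
  by move=> /= ->; split_if; split; lia.
case: lb => [/(_ isT)[-> ->] _ /(_ isT) uP | _ _ _].
  by move=> /= ->; split_if; split; lia.
by case: la; case: rb => /= ->; split_if; split; lia.
Qed.

(* The number of cells, counted from cell [m], passed by a cluster whose clock [a]
   advances by [r] at each step: in each clock period [P] it moves while
   [a %% P < 2 * m * r] and then waits. *)
Definition wave_lift (m P r a : nat) : nat :=
  2 * m * (a %/ P) + minn (2 * m) (a %% P %/ r).

Definition wave_cell (m P r a : nat) : nat := (wave_lift m P r a + m) %% (2 * m).

Lemma wave_cell_lt m P r a : 0 < m -> wave_cell m P r a < 2 * m.
Proof. by move=> m_gt0; rewrite ltn_mod muln_gt0. Qed.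

(** * One cluster in a travelling wave *)

Section Wave.
Variables (m l P r : nat).
Hypotheses (m_gt0 : 0 < m) (l_gt0 : 0 < l) (l_le_m : l <= m) (r_gt0 : 0 < r).
(** The waiting part of a clock period is nonempty and at most [r * l] units long, where one step is
    [r] units. *)
Hypotheses (P_gt : 2 * m * r < P) (P_le : P <= r * (2 * m + l)).

Let P_gt0 : 0 < P. Proof. exact: leq_ltn_trans P_gt. Qed.

Lemma wave_liftDP a k : wave_lift m P r (a + k * P) = wave_lift m P r a + 2 * m * k.
Proof.
by rewrite /wave_lift [a + _]addnC modnMDl divnMDl // mulnDr -addnA addnC.
Qed.

Lemma wave_cellDP a k : wave_cell m P r (a + k * P) = wave_cell m P r a.
Proof.
by rewrite /wave_cell wave_liftDP addnAC [2 * m * k]mulnC [_ + k * _]addnC modnMDl.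
Qed.

Lemma wave_liftS a :
  wave_lift m P r (a + r) = wave_lift m P r a + (a %% P < 2 * m * r).
Proof.
have rP : r < P by nia.
rewrite /wave_lift {1 2}(divn_eq a P) -addnA; have := ltn_pmod a P_gt0.
set q := a %/ P; set s := a %% P => s_lt.
have [sr|sr] := ltnP (s + r) P.
  rewrite divnMDl // modnMDl divn_small // modn_small // addn0.
  rewrite divnDr // divnn r_gt0 -ltn_divLR //; lia.
have -> : q * P + (s + r) = q.+1 * P + (s + r - P) by rewrite mulSn; lia.
rewrite divnMDl // modnMDl divn_small ?modn_small ?addn0; try lia.
rewrite [(s + r - P) %/ r]divn_small; last lia.
(* A wrap requires [s + r >= P > 2 * m * r], so at least [2 * m - 1] cells of the lap are passed;
   the last one is passed now or was passed before. *)
have ge : (2 * m).-1 <= s %/ r by rewrite leq_divRL //; nia.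
by rewrite -ltn_divLR //; nia.
Qed.

Lemma wave_cellS a : wave_cell m P r (a + r) =
  advance m (2 * m * r <= a %% P) (wave_cell m P r a).
Proof.
rewrite /wave_cell wave_liftS /advance (leqNgt (2 * m * r)).
case: (a %% P < 2 * m * r) => /=; last by rewrite addn0.
rewrite addnAC -modnDml; have : (wave_lift m P r a + m) %% (2 * m) < 2 * m.
  by rewrite ltn_mod; lia.
move: (_ %% (2 * m)) => c; rewrite /= addn1;
  case: eqVneq => [<-|ne c_lt]; first by rewrite modnn.
by rewrite modn_small //; lia.
Qed.

(* The rotated cell [wave_cell - m] of a contour in state [a] is [a %% P %/ r]
   while the cluster moves and 0 while it waits. *)
Lemma wave_cellE a : wave_cell m P r a =
  if a %% P < m * r then a %% P %/ r + m
  else if a %% P < 2 * m * r then a %% P %/ r - m else m.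
Proof.
rewrite /wave_cell /wave_lift -addnA -[2 * m * _]mulnC modnMDl.
rewrite -[_ < m * r]ltn_divLR // -[_ < 2 * m * r]ltn_divLR //.
set c := _ %/ r; split_if; [|have cm : m <= c by lia|].
- by rewrite modn_small; lia.
- have -> : minn (2 * m) c + m = c - m + 2 * m by lia.
  by rewrite modnDr modn_small; lia.
have -> : minn (2 * m) c + m = m + 2 * m by lia.
by rewrite modnDr modn_small; lia.
Qed.

(** There is at most one wrap, since [r * (m + l) <= 2 * m * r < P]. *)
Let modD a : (a + r * (m + l)) %% P =
  if a %% P + r * (m + l) < P then a %% P + r * (m + l)
  else a %% P + r * (m + l) - P.
Proof.
rewrite -modnDml; have := ltn_pmod a P_gt0; set s := a %% P => s_lt.
case: ltnP => H; first by rewrite modn_small.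
rewrite -{1}(subnK H) modnDr modn_small //; nia.
Qed.

Let divE k s : (k <= s %/ r) = (k * r <= s).
Proof. exact: leq_divRL. Qed.

(** The clock ahead by [r * (m + l)] will be that of the preceding contour, so this gives both
    admissibility and the absence of delays at right nodes. *)
Lemma wave_unoccupied a :
  (wave_cell m P r (a + r * (m + l)) < l) && (m < wave_cell m P r a < m + l)
    = false.
Proof.
rewrite !wave_cellE.
have := modD a; have := ltn_pmod a P_gt0.
have := ltn_pmod (a + r * (m + l)) P_gt0.
move: (a %% P) (_ %% P) => s s' s'_lt s_lt s'E.
have {}s'E : s' = s + r * (m + l) \/ s' + P = s + r * (m + l).
  by move: s'E; case: ltnP; lia.
have := divE (2 * m) s; have := divE 1 s; have := divE l s; have := divE m s.
have := divE m s'; have := divE (m + l) s'.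
move: (s %/ r) (s' %/ r) => q q'.
split_if; nia.
Qed.

(** The neighbour is [m + l] steps ahead. A wait lasts at most [r * l] clock units, so when it
    begins the neighbour has already run [m] cells from cell [m] and reached cell 0; the wait ends
    when the neighbour leaves cell [l - 1]. *)
Lemma wave_held a :
  (wave_cell m P r a == m) && (wave_cell m P r (a + r * (m + l)) < l)
    = (2 * m * r <= a %% P).
Proof.
rewrite !wave_cellE.
have := modD a; have := ltn_pmod a P_gt0.
have := ltn_pmod (a + r * (m + l)) P_gt0.
move: (a %% P) (_ %% P) => s s' s'_lt s_lt s'E.
have {}s'E : s' = s + r * (m + l) \/ s' + P = s + r * (m + l).
  by move: s'E; case: ltnP; lia.
have := divE (2 * m) s; have := divE 1 s; have := divE l s; have := divE m s.
have := divE 1 s'; have := divE m s'; have := divE (m + l) s'.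
move: (s %/ r) (s' %/ r) => q q'.
split_if; nia.
Qed.
End Wave.

(** This bounds the spread of the possible lap counts, and thereby the number of velocities. *)
Lemma laps_count N m l r s : 0 < m -> l <= m ->
  2 * m * r < N * (m + l) -> N * (m + l) <= s * (2 * m + l) -> s <= r ->
  3 * (r - s + 1) <= N.
Proof.
move=> m_gt0 l_le_m Hr Hs sr.
rewrite leqNgt; apply/negP => H.
have rN : r < N by nia.
(* In terms of [j] and [g], the bound on [r] reads [N * j < 2 * m * g]. The bound on [s] and the
   negated claim give the opposite inequality, because [g <= 3 * g - 2] and [2 * m <= 3 * m - j]. *)
set j := m - l; have lE : l = m - j by lia.
set g := N - r; have g0 : 0 < g by lia.
have A1 : N * j < 2 * m * g by nia.
have A2 : (3 * g - 2) * (3 * m - j) <= N * j by nia.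
have A3 : g * (2 * m) <= (3 * g - 2) * (3 * m - j) by apply: leq_mul; lia.
lia.
Qed.

(** Here [N * (m + l) <= (N + 1) * m], so [r <= N./2], and [N./2] laps are too short even with
    maximal waits. *)
Lemma small_odd_laps N m l r : odd N -> 0 < m -> 0 < l -> N * l <= m ->
  2 * m * r < N * (m + l) -> r * (2 * m + l) < N * (m + l).
Proof.
move=> oddN m_gt0 l_gt0 Nl H.
have NE : N = 2 * N./2 + 1 by rewrite -{1}(odd_double_half N) oddN; lia.
move: (N./2) NE Nl H => h -> {oddN} Nl H.
have rh : r <= h by nia.
nia.
Qed.

(** Here [N * (m + l) <= (N + 2) * m], and again [r <= N./2]. *)
Lemma small_even_laps N m l r : ~~ odd N -> 0 < N -> 0 < m -> 0 < l -> N * l <= 2 * m ->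
  2 * m * r < N * (m + l) -> r * (2 * m + l) < N * (m + l).
Proof.
move=> oddN N_gt0 m_gt0 l_gt0 Nl H.
have NE : N = 2 * N./2 by rewrite -{1}(odd_double_half N) (negbTE oddN); lia.
move: (N./2) NE N_gt0 Nl H => h -> {oddN} h0 Nl H.
have rh : r <= h by nia.
nia.
Qed.

(** A common form for both kinds of delays: [lead i] is the neighbour for which cluster [i] waits,
    and [y] counts cells from the waiting cell. Right waits give [ordS] as [lead]; left waits give
    [ord_pred], after a shift by [m]. *)
Record follows (I : Type) (lead : I -> I) (m l : nat) (y : nat -> I -> nat)
    (f : nat -> I -> bool) : Prop := Follows {
  follows_lt : forall t i, y t i < 2 * m;
  follows_held : forall t i,
    f t i = (y t i == 0) && (phase m (y t i) (y t (lead i)) < l);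
  follows_advance : forall t i, y t.+1 i = advance m (f t i) (y t i)}.

(* In a time window of length [N * (m + l)] each cluster makes [r] laps, each
   lasting at least [2 * m] and at most [2 * m + l]. *)
Definition eventually_laps (I : Type) (N m l : nat) (f : nat -> I -> bool) : Prop :=
  exists t0, forall i, exists r,
  [/\ forall t, t0 <= t -> f (t + N * (m + l)) i = f t i,
      \sum_(t < N * (m + l)) ~~ f (t0 + t) i = 2 * m * r
    & N * (m + l) <= r * (2 * m + l)].

Lemma uniform_time (I : finType) (P : I -> nat -> Prop) :
  (forall i, exists t0, forall t, t0 <= t -> P i t) ->
  exists t0, forall i t, t0 <= t -> P i t.
Proof.
move=> /fin_all_exists[g gP]; exists (\max_i g i) => i t le_t.
by apply: gP; apply: leq_trans le_t; exact: leq_bigmax.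
Qed.

(** * Spreading of delays around the chain *)

Section Spread.
Variables (I : finType) (lead : I -> I) (m l : nat).
Variables (y : nat -> I -> nat) (f : nat -> I -> bool).
Hypotheses (m_gt0 : 0 < m) (l_le_m : l <= m) (yf : follows lead m l y f).

Let gap t i := phase m (y t i) (y t (lead i)).

Hypothesis transport : forall t i,
  (l - gap t.+1 i) + f t i = (l - gap t i) + f t (lead i).
Hypothesis lead_conn : forall i j, exists k, iter k lead i = j.

Let gap_next t i : gap t.+1 i =
  if f t i == f t (lead i) then gap t i
  else if f t i then advance m false (gap t i)
  else if gap t i == 0 then (2 * m).-1 else (gap t i).-1.
Proof.
by rewrite /gap !(follows_advance yf) phase_advance ?(follows_lt yf).
Qed.

(** A gap grows only during a delay, when it is below [l]; a wrap from 0 to [2 * m - 1] would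
    contradict [transport]. *)
Let gap_le t i : gap t i <= l -> gap t.+1 i <= l.
Proof.
have := transport t i; have := follows_held yf t i; rewrite -/(gap t i).
rewrite gap_next /advance; case: (f t i); case: (f t (lead i)) => /=;
  by split_if; lia.
Qed.

(** Cluster [i] is not delayed before it reaches cell 0, so [transport] keeps its wait positive
    until then. *)
Let held_later t i : gap t i < l -> exists2 t', t <= t' & f t' i.
Proof.
have [k] := ubnP (2 * m - y t i); elim: k t => // k IH t lek gt.
have fE := follows_held yf t i; rewrite -/(gap t i) gt andbT in fE.
have [y0|yn0] := eqVneq (y t i) 0; first by exists t; rewrite // fE y0.
have f0 : f t i = false by rewrite fE (negbTE yn0).
have g1 : gap t.+1 i < l by have := transport t i; rewrite f0; lia.
have yE := follows_advance yf t i; rewrite f0 /advance in yE.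
have := follows_lt yf t i.
have [yl|yl] := eqVneq (y t i).+1 (2 * m); last first.
  rewrite (negbTE yl) in yE => ylt.
  have [|t' le_t' ?] := IH t.+1 _ g1; first by rewrite yE; lia.
  by exists t' => //; lia.
rewrite yl eqxx in yE => _; exists t.+1 => //.
by rewrite (follows_held yf) yE /= -{1}yE.
Qed.

Let gap_spread t i : f t (lead i) -> gap t.+1 i < l.
Proof.
move=> fl; have := transport t i; have := follows_held yf t i.
rewrite -/(gap t i) fl; case: (f t i) => /= H; lia.
Qed.

(** A delay of the leader leaves its follower a positive wait, which is later served as a delay; so
    one delay travels around the whole chain. *)
Lemma gap_eventually_le t0 i0 : f t0 i0 ->
  exists t1, forall i t, t1 <= t -> phase m (y t i) (y t (lead i)) <= l.
Proof.
move=> f0; apply: (@uniform_time _ (fun i t => gap t i <= l)) => i.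
suff [t gt] : exists t, gap t i < l.
  exists t => s /subnKC <-; elim: (s - t) => [|n IH]; first by rewrite addn0 ltnW.
  by rewrite addnS gap_le.
have [k] := lead_conn i i0; elim: k i => [i /= ->|k IH i].
  by exists t0; move: f0; rewrite (follows_held yf) => /andP[].
rewrite iterSr => /IH[t /held_later[t' _ /gap_spread]]; by exists t'.+1.
Qed.
End Spread.

(** * Repetition of the leader's motion with lag [m + l] *)

Section Following.
Variables (I : finType) (lead : I -> I) (m l N : nat).
Variables (y : nat -> I -> nat) (f : nat -> I -> bool).
Hypotheses (m_gt0 : 0 < m) (l_le_m : l <= m) (yf : follows lead m l y f).
Hypothesis lead_iter : forall i, iter N lead i = i.

Let gap t i := phase m (y t i) (y t (lead i)).

Hypothesis gap_le : forall t i, gap t i <= l.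

Let held_eq0 t i : f t i -> y t i = 0.
Proof. by rewrite (follows_held yf) => /andP[/eqP]. Qed.

Let unheld t i : y t i != 0 -> f t i = false.
Proof. by rewrite (follows_held yf) => /negbTE->. Qed.

Let unheld_gap t i : y t i = 0 -> f t i = false -> gap t i = l.
Proof.
by have := gap_le t i; rewrite (follows_held yf) -/(gap t i) => ? -> /=; lia.
Qed.

Let run t i j : y t i = 0 -> f t i = false -> j < 2 * m -> y (t + j) i = j.
Proof.
move=> y0 f0; elim: j => [|j IH] ltj; first by rewrite addn0.
have yj := IH (ltnW ltj).
rewrite addnS (follows_advance yf) yj /advance.
suff -> : f (t + j) i = false by rewrite ifN //; lia.
by case: j yj {IH ltj} => [|j] yj; [rewrite addn0 | rewrite unheld // yj].
Qed.

Let run_full t i : y t i = 0 -> f t i = false -> y (t + 2 * m) i = 0.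
Proof.
move=> y0 f0; have E : 2 * m = (2 * m).-1.+1 by lia.
rewrite E addnS (follows_advance yf) (@run t i) //; last lia.
rewrite /advance -E eqxx unheld // (@run t i) //; lia.
Qed.

(** The gap bound brings the cluster to cell 0 in time, and there it waits until the leader has run
    [m + l] cells, when the gap equals [l]. *)
Let departure t i : y t (lead i) = 0 -> f t (lead i) = false ->
  y (t + (m + l)) i = 0 /\ f (t + (m + l)) i = false.
Proof.
move=> y0 f0.
(* The second alternative says that the distance [2 * m - y] to cell 0 is at most the remaining time
   [m + l - j]. *)
have H j : m <= j -> j <= m + l ->
    y (t + j) i = 0 \/ 2 * m + j <= y (t + j) i + (m + l).
  elim: j => [|j IH]; first lia.
  rewrite leq_eqVlt => /orP[/eqP <- _|lemj lej].
    have := gap_le (t + m) i; rewrite /gap (@run t (lead i)) //; last lia.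
    have := follows_lt yf (t + m) i; rewrite /phase; split_if; lia.
  rewrite addnS (follows_advance yf).
  have ltj : j < 2 * m by lia.
  have := IH lemj (ltnW lej); have [y1 _|y1] := eqVneq (y (t + j) i) 0.
    left; rewrite (follows_held yf) y1 (@run t (lead i)) //= /phase /advance.
    split_if; lia.
  rewrite unheld // /advance; have := follows_lt yf (t + j) i; split_if; lia.
have yT : y (t + (m + l)) i = 0.
  have := H (m + l); have := follows_lt yf (t + (m + l)) i; lia.
split=> //; rewrite (follows_held yf) yT /=.
(* For [l = m] the leader has just completed its lap and is back in cell 0. *)
have [ml|ml] := eqVneq (m + l) (2 * m).
  rewrite ml (@run_full t (lead i)) // /phase; split_if; lia.
rewrite (@run t (lead i)) //; last lia.
rewrite /phase; split_if; lia.
Qed.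

(** The leader of a delayed cluster lies in cells [m] to [m + l - 1], where it cannot be delayed
    itself. *)
Let gap_held t i : f t i -> gap t.+1 i = (gap t i).+1.
Proof.
move=> ft; have := ft; rewrite (follows_held yf) => /andP[/eqP y0].
rewrite -/(gap t i) => gt; have := follows_lt yf t (lead i).
rewrite {1}/gap !(follows_advance yf) phase_advance ?(follows_lt yf) //.
rewrite -/(gap t i) ft unheld; last first.
  by move: gt; rewrite /gap y0 /phase; split_if; lia.
by rewrite /advance /=; split_if; lia.
Qed.

Let wait t i : f t i ->
  exists w, [/\ 0 < w <= l, y (t + w) i = 0 & f (t + w) i = false].
Proof.
move=> ft; suff [w [? ? ?]] : exists w, [/\ 0 < w <= l - gap t i,
    y (t + w) i = 0 & f (t + w) i = false] by exists w; split=> //; lia.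
have [k] := ubnP (l - gap t i); elim: k t ft => // k IH t ft lek.
have := ft; rewrite (follows_held yf) => /andP[y0]; rewrite -/(gap t i) => gt.
have y1 : y t.+1 i = 0 by rewrite (follows_advance yf) ft /=; apply/eqP.
case f1: (f t.+1 i); last by exists 1; rewrite addn1; split=> //; lia.
have := IH _ f1; rewrite gap_held // => -[|w [? ? ?]]; first lia.
by exists w.+1; rewrite addnS -addSn; split=> //; lia.
Qed.

Let departs i : exists t, y t i = 0 /\ f t i = false.
Proof.
suff [t y0] : exists t, y t i = 0.
  case ft: (f t i); last by exists t.
  by have [w [_ ? ?]] := wait ft; exists (t + w).
suff H k : exists t, y t i = 0 \/ k <= y t i.
  by have [t [|]] := H (2 * m); [exists t | have := follows_lt yf t i; lia].
elim: k => [|k [t [?|le_k]]]; [by exists 0; right | by exists t; left |].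
have [?|yn0] := eqVneq (y t i) 0; first by exists t; left.
by exists t.+1; rewrite (follows_advance yf) unheld // /advance; case: ifP; lia.
Qed.

Let follow_step t i : y (t + (m + l)) i = y t (lead i) ->
  y (t.+1 + (m + l)) i = y t.+1 (lead i).
Proof.
move=> E; rewrite addSn !(follows_advance yf) E.
have [y0|yn0] := eqVneq (y t (lead i)) 0; last by rewrite !unheld ?E.
case ft: (f t (lead i)); last by rewrite (departure y0 ft).2.
(* The leader waits [w] more steps, so at time [t + (m + l)] it has run [m + l - w] cells, and the
   gap [l - w] still holds the follower. *)
have [w [lw yw fw]] := wait ft.
suff -> : f (t + (m + l)) i by [].
rewrite (follows_held yf) E y0 eqxx /=.
have -> : t + (m + l) = t + w + (m + l - w) by lia.
rewrite run //; last lia.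
by rewrite /phase; split_if; lia.
Qed.

Lemma follow_eventually : exists t0, forall i t, t0 <= t ->
  y (t + (m + l)) i = y t (lead i).
Proof.
apply: (@uniform_time _ (fun i t => y (t + (m + l)) i = y t (lead i))) => i.
have [t [y0 f0]] := departs (lead i); exists t => s /subnKC <-.
elim: (s - t) => [|n IH]; last by rewrite addnS follow_step.
by rewrite addn0 y0 (departure y0 f0).1.
Qed.

Lemma follow_period : exists t0, forall i t, t0 <= t ->
  y (t + N * (m + l)) i = y t i.
Proof.
have [t0 H] := follow_eventually; exists t0 => i t let0.
rewrite -{2}(lead_iter i); elim: N i => [|k IH] i; first by rewrite addn0.
rewrite iterSr -IH mulSn [m + l + _]addnC addnA H //; lia.
Qed.

Let moved i s n := \sum_(t < n) ~~ f (s + t) i.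
Let laps i s n := \sum_(t < n) ((y (s + t) i).+1 == 2 * m).

Let moved_laps i s n : y (s + n) i + 2 * m * laps i s n = y s i + moved i s n.
Proof.
elim: n => [|n]; first by rewrite /laps /moved !big_ord0 addn0 muln0.
rewrite /laps /moved !big_ord_recr /= mulnDr addnS (follows_advance yf).
have := @held_eq0 (s + n) i; rewrite /advance.
by case: (f _ _) => H; split_if; rewrite /= ?muln1 ?muln0; lia.
Qed.

(* The gap at cell 0 counts the time already waited in the current lap. *)
Let waited t i := if y t i == 0 then gap t i else l.

(** Every step is a move or a delay, and the delays of one lap raise the gap at cell 0 to at most
    [l]. *)
Let waited_laps i s n :
  n + waited s i <= waited (s + n) i + l * laps i s n + moved i s n.
Proof.
elim: n => [|n]; first by rewrite /laps /moved !big_ord0 addn0 muln0 !addn0.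
rewrite /laps /moved !big_ord_recr /= mulnDr addnS; set a := \sum_(i0 < n) _.
set b := \sum_(i0 < n) _; rewrite /waited (follows_advance yf).
have := @gap_held (s + n) i; have := @held_eq0 (s + n) i.
have := @unheld_gap (s + n) i.
have := gap_le (s + n) i; have := follows_lt yf (s + n) i.
rewrite /advance; case: (f _ _) => ? ? H0 H1 H2 /=.
  by rewrite H1 // eqxx H2 //; lia.
by split_if; rewrite /= ?muln1 ?muln0; lia.
Qed.

(** Over one period the boundary terms of the two counts cancel. *)
Lemma following_laps : eventually_laps N m l f.
Proof.
have [t0 H] := follow_period; exists t0 => i.
exists (laps i t0 (N * (m + l))); split=> [t let0||].
- by rewrite !(follows_held yf) !H.
- by have := moved_laps i t0 (N * (m + l)); rewrite H // /moved; lia.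
have := moved_laps i t0 (N * (m + l)); have := waited_laps i t0 (N * (m + l)).
by rewrite /waited /gap !H //; lia.
Qed.
End Following.

Lemma chain_laps (I : finType) (lead : I -> I) (m l N : nat)
    (y : nat -> I -> nat) (f : nat -> I -> bool) :
    0 < m -> l <= m -> follows lead m l y f ->
    (forall i, iter N lead i = i) ->
    (forall i j, exists k, iter k lead i = j) ->
    (forall t i, (l - phase m (y t.+1 i) (y t.+1 (lead i))) + f t i =
                 (l - phase m (y t i) (y t (lead i))) + f t (lead i)) ->
    (exists t i, f t i) ->
  eventually_laps N m l f.
Proof.
move=> m_gt0 l_le_m yf lead_iter lead_conn transport [t [i fti]].
have [t1 Ht1] := gap_eventually_le m_gt0 l_le_m yf transport lead_conn fti.
have yf1 : follows lead m l (fun t => y (t1 + t)) (fun t => f (t1 + t)).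
  by case: yf => H1 H2 H3; split=> s j; rewrite ?addnS.
have gap1 s j : phase m (y (t1 + s) j) (y (t1 + s) (lead j)) <= l.
  by apply: Ht1; exact: leq_addr.
have [t0 H] := following_laps m_gt0 l_le_m yf1 lead_iter gap1.
exists (t1 + t0) => j; have [r [per sum ler]] := H j; exists r; split=> //.
  move=> s les; have := per (s - t1).
  by rewrite addnA subnKC; [apply; lia | lia].
by rewrite -sum; apply: eq_bigr => s _; rewrite addnA.
Qed.

(** * Cyclic order of the contours and explicit form of the delays *)

Lemma val_iter_ordS N (i : 'I_N) k : val (iter k (@ordS N) i) = (i + k) %% N.
Proof.
elim: k => [|k IH]; first by rewrite /= addn0 modn_small.
by rewrite iterS /= IH addnS -addn1 modnDml addn1.
Qed.

Lemma iter_ordS N (i : 'I_N) : iter N (@ordS N) i = i.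
Proof. by apply: val_inj; rewrite val_iter_ordS modnDr modn_small. Qed.

Lemma ordS_connected N (i j : 'I_N) : exists k, iter k (@ordS N) i = j.
Proof.
exists (j + N - i); apply: val_inj; rewrite val_iter_ordS subnKC.
  by rewrite modnDr modn_small.
by apply: leq_trans (ltnW (ltn_ord i)) _; rewrite leq_addl.
Qed.

Lemma iter_ordSK N k : cancel (iter k (@ordS N)) (iter k (@ord_pred N)).
Proof. by move=> i; elim: k => // k IH; rewrite iterSr iterS ordSK IH. Qed.

Lemma iter_ord_pred N (i : 'I_N) : iter N (@ord_pred N) i = i.
Proof. by rewrite -{1}(iter_ordS i) iter_ordSK. Qed.

Lemma ord_pred_connected N (i j : 'I_N) : exists k, iter k (@ord_pred N) i = j.
Proof. by have [k <-] := ordS_connected j i; exists k; rewrite iter_ordSK. Qed.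

Lemma ordS_induction N (P : pred 'I_N) i0 :
  P i0 -> (forall i, P i -> P (ordS i)) -> forall i, P i.
Proof.
by move=> P0 PS i; have [k <-] := ordS_connected i0 i; elim: k => //= k /PS.
Qed.

(** The cells with [c + m < l] come from the wrap past cell [2 * m - 1]; there are none if
    [l <= m]. *)
Lemma occupies_leftE m l (c : 'I_(2 * m)) : l < 2 * m ->
  occupies_left l c = (m < c < m + l) || (c + m < l).
Proof.
move=> lm; apply/existsP/idP => [[k /andP[k0 /eqP ->]]|H].
  have : k < l := ltn_ord k.
  move: (nat_of_ord k) k0 => {}k k0 kl; have [km|km] := ltnP (m + k) (2 * m).
    by rewrite modn_small //; lia.
  by rewrite -[X in X %% _](subnK km) modnDr modn_small; lia.
have [cm|cm] := ltnP m c.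
  have ltk : c - m < l by lia.
  exists (Ordinal ltk) => /=; rewrite subnKC ?(ltnW cm) // modn_small //.
  by rewrite eqxx subn_gt0 cm.
have ltk : c + m < l by lia.
have c2 := ltn_ord c.
exists (Ordinal ltk) => /=; have -> : m + (c + m) = c + 2 * m by lia.
by rewrite modnDr modn_small // eqxx andbT; lia.
Qed.

Lemma delayedE N m l (x : state N m) i : 0 < l < 2 * m ->
  delayed l x i =
    (x i == 0 :> nat) && ((m < x (ordS i) < m + l) || (x (ordS i) + m < l))
    || (x i == m :> nat) && (x (ord_pred i) < l).
Proof.
move=> /andP[l_gt0 l_lt]; rewrite /delayed occupies_leftE // /occupies_right.
rewrite -andb_orr; congr (_ || _ && _).
by case: (nat_of_ord (x (ord_pred i))) => [|n]; rewrite ?l_gt0 ?orbF.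
Qed.

Lemma step_advance N m l (x : state N m) i :
  step l x i = advance m (delayed l x i) (x i) :> nat.
Proof.
rewrite ffunE /advance; case: (delayed _ _ _) => //=.
have := ltn_ord (x i); case: eqVneq => [->|H H']; first by rewrite modnn.
by rewrite modn_small // ltn_neqAle H H'.
Qed.

Lemma trajectoryD N m l (x : state N m) s t :
  trajectory l (trajectory l x s) t = trajectory l x (s + t).
Proof. by rewrite addnC /trajectory iterD. Qed.

(** * Collapse for [l > m] *)

Section Collapse.
Variables (N m l : nat) (x : state N m).
Hypotheses (m_gt0 : 0 < m) (m_lt_l : m < l) (l_lt : l < 2 * m).

Let pos t i : nat := trajectory l x t i.

Let posS t i : pos t.+1 i = advance m (delayed l (trajectory l x t) i) (pos t i).
Proof. exact: step_advance. Qed.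

Let pos_lt t i : pos t i < 2 * m. Proof. exact: ltn_ord. Qed.

Let held_pos t i : delayed l (trajectory l x t) i =
    (pos t i == 0) && ((m < pos t (ordS i) < m + l) || (pos t (ordS i) + m < l))
    || (pos t i == m) && (pos t (ord_pred i) < l).
Proof. by apply: delayedE; rewrite l_lt (leq_ltn_trans _ m_lt_l). Qed.

(** A cluster in cell [m] is blocked by its predecessor, since cells 1 to [m] are all below [l]; so
    every cluster runs up to cell [m] and stops. *)
Lemma collapse_right : (forall i, 0 < x i <= m) -> results_in l (collapse l) x.
Proof.
move=> x_right.
have held t : (forall i, 0 < pos t i <= m) ->
    forall i, delayed l (trajectory l x t) i = (pos t i == m).
  move=> H i; have := H i; have := H (ord_pred i).
  by rewrite held_pos; lia.
have H t i : 0 < pos t i <= m /\ (t < pos t i \/ pos t i = m).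
  elim: t i => [|t IH] i; first by have : 0 < pos 0 i <= m := x_right i; lia.
  rewrite posS held; last by move=> j; case: (IH j).
  by have := IH i; rewrite /advance; split_if; lia.
exists m => t i; rewrite trajectoryD held => [|j]; last by case: (H (m + t) j).
by have := H (m + t) i; lia.
Qed.

(** The mirror case: for [l > m], cell 0 and all cells beyond [m] occupy the left node, so every
    cluster stops in cell 0. *)
Lemma collapse_left : (forall i, x i = 0 :> nat \/ m < x i) ->
  results_in l (collapse l) x.
Proof.
move=> x_left.
have held t : (forall i, pos t i = 0 \/ m < pos t i) ->
    forall i, delayed l (trajectory l x t) i = (pos t i == 0).
  move=> H i; have := H i; have := H (ordS i); have := pos_lt t (ordS i);
    have := pos_lt t i.
  by rewrite held_pos; lia.
have H t i : pos t i = 0 \/ m + t < pos t i.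
  elim: t i => [|t IH] i; first by have : pos 0 i = 0 \/ m < pos 0 i := x_left i; lia.
  rewrite posS held; last by move=> j; case: (IH j); lia.
  by have := IH i; rewrite /advance; split_if; lia.
exists m => t i; rewrite trajectoryD held => [|j]; last by case: (H (m + t) j); lia.
by have := pos_lt (m + t) i; have := H (m + t) i; lia.
Qed.

(** If a cluster occupies its right node, admissibility puts the next one in cells 1 to [m], where
    it occupies its own right node because [m < l]; this goes round the chain. *)
Lemma collapse_eventually : admissible l x -> results_in l (collapse l) x.
Proof.
move=> /forallP adm.
have adm' i : occupies_right l (x i) -> 0 < x (ordS i) <= m.
  move=> H; have := adm i; have := ltn_ord (x (ordS i)).
  by rewrite H /= occupies_leftE //; lia.
case: (pickP (fun i => occupies_right l (x i))) => [i0 H0|H].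
  have all_right : forall i, occupies_right l (x i).
    apply: (@ordS_induction _ (fun i => occupies_right l (x i)) i0) => //.
    by move=> i /adm'; rewrite /occupies_right; lia.
  by apply: collapse_right => i; rewrite -(ord_predK i) adm'.
apply: collapse_left => i.
by have := H i; have := ltn_ord (x i); rewrite /occupies_right; lia.
Qed.
End Collapse.

(** * Stabilization of the waits and separation of the two kinds *)

Lemma nonincreasing_stable (s : nat -> nat) t1 :
  (forall t, t1 <= t -> s t.+1 <= s t) ->
  exists2 t0, t1 <= t0 & forall t, t0 <= t -> s t.+1 = s t.
Proof.
have [k] := ubnP (s t1); elim: k t1 => // k IH t1 lek mono.
have [[t2 le2 lt2]|no] := pselect (exists2 t, t1 <= t & s t < s t1).
  have [||t0 le0 H] := IH t2; first by apply: leq_trans lt2 _.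
    by move=> t let_; apply: mono; apply: leq_trans let_.
  by exists t0 => //; apply: leq_trans le0.
have E t : t1 <= t -> s t = s t1.
  move=> let_; apply/eqP; rewrite eqn_leq; apply/andP; split; last first.
    by rewrite leqNgt; apply/negP => lt; apply: no; exists t.
  by rewrite -(subnKC let_); elim: (t - t1) => [|n IHn]; rewrite ?addn0 // addnS;
    apply: leq_trans IHn; apply: mono; exact: leq_addr.
by exists t1 => // t let_; rewrite !E // leqW.
Qed.

Lemma eq_from_leq_sum (I : finType) (F G : I -> nat) :
  (forall i, F i <= G i) -> \sum_i G i <= \sum_i F i -> forall i, F i = G i.
Proof.
move=> le_FG ge_sum i.
have [/= le_sum] := leqif_sum (fun i (_ : true) => leqif_eq (le_FG i)).
rewrite eqn_leq le_sum ge_sum /= => /esym/forallP/(_ i)/eqP; exact.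
Qed.

Section Exact.
Variables (N m l : nat).
Hypotheses (m_gt0 : 0 < m) (l_gt0 : 0 < l) (l_le_m : l <= m).
Variable (y : nat -> 'I_N -> nat).

Let R t i := held_right m l (y t i) (y t (ordS i)).
Let L t i := held_left m l (y t (ord_pred i)) (y t i).
Let u t i := phase m (y t i) (y t (ordS i)).
Let cp t i := right_wait l (u t i).
Let cn t i := left_wait m l (u t i).

Hypothesis y_lt : forall t i, y t i < 2 * m.
Hypothesis y_step : forall t i, y t.+1 i = advance m (R t i || L t i) (y t i).

Let LS t i : L t (ordS i) = held_left m l (y t i) (y t (ordS i)).
Proof. by rewrite /L ordSK. Qed.

Let node t i := @node_step m l (y t i) (y t (ordS i)) (L t i) (R t (ordS i))
  m_gt0 l_gt0 l_le_m (y_lt t i) (y_lt t (ordS i))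
  (fun H => eqP (andP H).1) (fun H => eqP (andP H).1).

Let sum_ordS (F : 'I_N -> nat) : \sum_i F (ordS i) = \sum_i F i.
Proof. by rewrite [RHS](reindex_inj (@ordS_inj N)). Qed.

Let node1 t i : cp t.+1 i + cn t.+1 i + R t i + L t (ordS i)
  <= cp t i + cn t i + L t i + R t (ordS i).
Proof. by have [+ _ _] := node t i; rewrite -LS /cp /cn /u !y_step. Qed.

Let node2 t i : cp t.+1 i + cn t.+1 i + R t i + L t (ordS i)
    = cp t i + cn t i + L t i + R t (ordS i) ->
  cn t i + L t i <= cn t.+1 i + L t (ordS i).
Proof. by have [_ + _] := node t i; rewrite -LS /cp /cn /u !y_step. Qed.

Let node3 t i : cp t.+1 i + cn t.+1 i + R t i + L t (ordS i)
    = cp t i + cn t i + L t i + R t (ordS i) ->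
  cn t i + L t i = cn t.+1 i + L t (ordS i) ->
  0 < cp t i -> L t i = false /\ R t i = (y t i == 0).
Proof. by have [_ _ +] := node t i; rewrite -LS /cp /cn /u !y_step. Qed.

(** Each kind of wait is conserved separately: a right delay of a cluster hands a unit to the node
    on its left, a left delay to the node on its right. *)
Let exact_at t i :=
  [/\ cp t.+1 i + R t i = cp t i + R t (ordS i),
      cn t.+1 i + L t (ordS i) = cn t i + L t i
    & 0 < cp t i -> L t i = false /\ R t i = (y t i == 0)].

Let exact_eventually : exists t0, forall t i, t0 <= t -> exact_at t i.
Proof.
pose S t := \sum_i (cp t i + cn t i); pose Q t := \sum_i cp t i.
pose M t := \sum_i cn t i.
have sumE t : \sum_i (cp t.+1 i + cn t.+1 i + R t i + L t (ordS i)) =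
    S t.+1 + (\sum_i R t i + \sum_i L t i).
  by rewrite -[\sum_i L t i]sum_ordS addnA -!big_split.
have sumE' t : \sum_i (cp t i + cn t i + L t i + R t (ordS i)) =
    S t + (\sum_i R t i + \sum_i L t i).
  by rewrite -[\sum_i R t i]sum_ordS [X in _ + X]addnC addnA -!big_split.
(* Once the total wait is stable, every node inequality is an equality. Only then is the total [M]
   of left waits known not to decrease, so that the total [Q] of right waits stabilizes too. *)
have [|t1 _ Ht1] := @nonincreasing_stable S 0.
  move=> t _; rewrite -(leq_add2r (\sum_i R t i + \sum_i L t i)) -sumE -sumE'.
  by apply: leq_sum => i _; exact: node1.
have eq1 t i : t1 <= t -> cp t.+1 i + cn t.+1 i + R t i + L t (ordS i)
    = cp t i + cn t i + L t i + R t (ordS i).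
  move=> let1; move: i; apply: eq_from_leq_sum; first exact: node1.
  by rewrite sumE sumE' Ht1.
have sumN t : S t = Q t + M t by rewrite /S big_split.
have leN t : t1 <= t -> M t <= M t.+1.
  move=> let1; rewrite -(leq_add2r (\sum_i L t i)) -{2}[\sum_i L t i]sum_ordS.
  by rewrite -!big_split; apply: leq_sum => i _; apply: node2; exact: eq1.
have [|t0 le10 Ht0] := @nonincreasing_stable Q t1.
  by move=> t let1; have := leN t let1; have := Ht1 t let1; rewrite !sumN; lia.
exists t0 => t i let0; have let1 := leq_trans le10 let0.
have eq2 : cn t i + L t i = cn t.+1 i + L t (ordS i).
  move: i; apply: eq_from_leq_sum => [i|]; first by apply: node2; exact: eq1.
  rewrite !big_split /= (sum_ordS (fun i => L t i : nat)) leq_add2r.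
  rewrite -/(M t) -/(M t.+1).
  by have := Ht1 t let1; have := Ht0 t let0; rewrite !sumN; lia.
have H := node3 (eq1 t i let1) eq2.
by split=> //; have := eq1 t i let1; lia.
Qed.

Section Eventually.
Variable t0 : nat.
Hypothesis exact : forall t i, t0 <= t -> exact_at t i.

Let R_cp t i : R t i -> 0 < cp t i.
Proof.
rewrite /R /cp /u /held_right /right_wait /phase => /andP[/eqP -> ?].
by split_if; lia.
Qed.

Let L_cn t i : L t (ordS i) -> 0 < cn t i.
Proof.
rewrite LS /cn /u /held_left /left_wait /phase => /andP[/eqP -> ?].
by split_if; lia.
Qed.

Let cp_receive t i : t0 <= t -> R t (ordS i) -> 0 < cp t.+1 i.
Proof.
move=> /exact-/(_ i)[E _ _] H; have := @R_cp t i; rewrite H in E.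
by case: (R t i) E => E; lia.
Qed.

Let cn_receive t i : t0 <= t -> L t i -> 0 < cn t.+1 i.
Proof.
move=> /exact-/(_ i)[_ E _] H; have := @L_cn t i; rewrite H in E.
by case: (L t (ordS i)) E => E; lia.
Qed.

(** The left wait at [j] moves only forward and the right wait at [i] only backward, so their
    distance [k] shrinks to 0, where one phase would have to carry both. *)
Let exclusive k t i j : t0 <= t -> iter k (@ordS N) j = i ->
  0 < cp t i -> cn t j = 0.
Proof.
move=> let0 E cp0; apply/eqP; rewrite -leqn0 leqNgt; apply/negP => cn0.
suff: iter k (@ordS N) j <> i by [].
move: {E} let0 cp0 cn0.
have [b] := ubnP k; elim: b k t i j => // b IHb k t i j ltk.
case: k ltk => [_ let0 cp0 cn0|k ltk].
  move=> /= E; move: cp0 cn0; rewrite -E /cp /cn /right_wait /left_wait.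
  by have : u t j < 2 * m; [exact: phase_lt | split_if; lia].
(* The inner measure is the time until cluster [i] reaches cell 0, where it must be delayed and
   hands its wait to [ord_pred i]. *)
have [w] := ubnP ((2 * m - y t i) * (y t i != 0)).
elim: w t i j => // w IHw t i j lew let0 cp0 cn0 E.
have [Ecp Ecn /(_ cp0)[L0 R0]] := exact i let0.
have [_ Ecn' _] := exact j let0.
have := iterSr k (@ordS N) j; rewrite E => E1.
case LS1: (L t (ordS j)).
  have cn1 := cn_receive let0 LS1.
  case R1: (R t i).
    have cp1 : 0 < cp t.+1 (ord_pred i) by apply: cp_receive; rewrite ?ord_predK.
    (* At distance one the waits would exchange nodes; cluster [i] would then be delayed at its left
       node, contrary to [L0]. *)
    clear IHw; case: k => [|k] in E1 ltk E *; first by rewrite E1 /= LS1 in L0.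
    apply: (IHb k t.+1 (ord_pred i) (ordS j)) => //; [lia | exact: leqW |].
    by rewrite E1 iterS ordSK.
  apply: (IHb k t.+1 i (ordS j)) => //; [exact: leqW | lia].
have cn1 : 0 < cn t.+1 j by lia.
case R1: (R t i).
  have cp1 : 0 < cp t.+1 (ord_pred i) by apply: cp_receive; rewrite ?ord_predK.
  apply: (IHb k t.+1 (ord_pred i) j) => //; first exact: leqW.
  by rewrite -E iterS ordSK.
rewrite R1 in R0.
have yE := y_step t i; rewrite L0 R1 /advance /= in yE.
apply: (IHw t.+1 i j) => //; [|exact: leqW|lia].
move: lew; rewrite yE; have := y_lt t i.
case: (eqVneq (y t i) 0) R0 => //= yn0 _; rewrite muln1.
by case: (eqVneq (y t i).+1) => [_|ne] /=; rewrite ?muln0 ?muln1; lia.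
Qed.

Let one_sided t : t0 <= t -> (forall i, cp t i = 0) \/ (forall i, cn t i = 0).
Proof.
move=> let0; have [[i cpi]|no] := pselect (exists i, 0 < cp t i).
  right=> j; have [k E] := ordS_connected j i; exact: exclusive E cpi.
by left=> i; apply/eqP; rewrite -leqn0 leqNgt; apply/negP => H; apply: no; exists i.
Qed.

Let cp_stays t : t0 <= t -> (forall i, cp t i = 0) -> forall i, cp t.+1 i = 0.
Proof.
move=> let0 cp0 i; have [E _ _] := exact i let0.
by have := @R_cp t (ordS i); rewrite !cp0 in E *; case: (R t (ordS i)) E; lia.
Qed.

Let cn_stays t : t0 <= t -> (forall i, cn t i = 0) -> forall i, cn t.+1 i = 0.
Proof.
move=> let0 cn0 i; have [_ E _] := exact i let0.
have := @L_cn t (ord_pred i); rewrite ord_predK !cn0 in E *.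
by case: (L t i) E; lia.
Qed.

Let held t i := R (t0 + t) i || L (t0 + t) i.

Let laps_or_free (lead : 'I_N -> 'I_N) (z : nat -> 'I_N -> nat) :
    follows lead m l z held ->
    (forall i, iter N lead i = i) ->
    (forall i j, exists k, iter k lead i = j) ->
    (forall t i, (l - phase m (z t.+1 i) (z t.+1 (lead i))) + held t i =
                 (l - phase m (z t i) (z t (lead i))) + held t (lead i)) ->
  (forall t i, ~~ held t i) \/
  eventually_laps N m l held.
Proof.
move=> zf lead_iter lead_conn transport.
have [ex|no] := pselect (exists t i, held t i).
  by right; exact: (chain_laps m_gt0 l_le_m zf).
by left=> t i; apply/negP => H; apply: no; exists t, i.
Qed.

Let right_case : (forall i, cn t0 i = 0) ->
  (forall t i, ~~ held t i) \/
  eventually_laps N m l held.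
Proof.
move=> cn0.
have {}cn0 t i : cn (t0 + t) i = 0.
  elim: t i => [|t IH] i; first by rewrite addn0.
  by rewrite addnS cn_stays // leq_addr.
have L0 t i : L (t0 + t) i = false.
  by apply/negP; rewrite -(ord_predK i) => /L_cn; rewrite cn0.
have u0 t i : 0 < u (t0 + t) i <= 2 * m - l.
  have := cn0 t i; have : u (t0 + t) i < 2 * m by exact: phase_lt.
  by rewrite /cn /left_wait; split_if; lia.
have cpE t i : cp (t0 + t) i = l - u (t0 + t) i.
  by have := u0 t i; rewrite /cp /right_wait; split_if; lia.
apply: (@laps_or_free (@ordS N) (fun t => y (t0 + t))).
- split=> t i; rewrite ?addnS //.
  rewrite /held L0 orbF /R /held_right; have := u0 t i; rewrite /u.
  have := y_lt (t0 + t) (ordS i).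
  by case: eqP => //= ->; rewrite /phase; split_if; lia.
- exact: iter_ordS.
- exact: ordS_connected.
move=> t i; rewrite -/(u _ _) -/(u (t0 + t) i) -!cpE /held !L0 !orbF addnS.
by have [] := exact i (leq_addr t t0).
Qed.

Let left_case : (forall i, cp t0 i = 0) ->
  (forall t i, ~~ held t i) \/
  eventually_laps N m l held.
Proof.
move=> cp0.
have {}cp0 t i : cp (t0 + t) i = 0.
  elim: t i => [|t IH] i; first by rewrite addn0.
  by rewrite addnS cp_stays // leq_addr.
have R0 t i : R (t0 + t) i = false by apply/negP => /R_cp; rewrite cp0.
(* The shift by [m] moves the waiting cell to 0, and exchanging the two clusters of a node reverses
   the sign of its phase; so the left case takes the form of the right one. *)
pose z t i := if m <= y (t0 + t) i then y (t0 + t) i - m else y (t0 + t) i + m.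
have cnE t i : cn (t0 + t) (ord_pred i) = l - phase m (z t i) (z t (ord_pred i)).
  rewrite /cn /u ord_predK /left_wait /z.
  have := y_lt (t0 + t) i; have := y_lt (t0 + t) (ord_pred i).
  move: (y _ i) (y _ (ord_pred i)) => b a; rewrite /phase; split_if; lia.
apply: (@laps_or_free (@ord_pred N) z).
- split=> t i.
  + by have := y_lt (t0 + t) i; rewrite /z; split_if; lia.
  + rewrite /held R0 /L /held_left /z.
    have := y_lt (t0 + t) i; have := y_lt (t0 + t) (ord_pred i).
    move: (y _ i) (y _ (ord_pred i)) => b a.
    case: eqP => [->|]; rewrite /phase; split_if; lia.
  + rewrite /z addnS y_step -/(held t i); have := y_lt (t0 + t) i.
    by rewrite /advance; case: (held t i); split_if; lia.
- exact: iter_ord_pred.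
- exact: ord_pred_connected.
move=> t i; rewrite -!cnE /held !R0 addnS.
by have [_ + _] := exact (ord_pred i) (leq_addr t t0); rewrite ord_predK.
Qed.

Let free_or_laps_after :
  (forall t i, ~~ held t i) \/
  eventually_laps N m l held.
Proof. by case: (one_sided (leqnn t0)) => [/left_case|/right_case]. Qed.

Lemma free_or_laps_eventually :
  (forall t i, ~~ (R (t0 + t) i || L (t0 + t) i)) \/
  eventually_laps N m l (fun t i => R t i || L t i).
Proof.
case: free_or_laps_after => [|[t1 H]]; [by left | right; exists (t0 + t1) => i].
have [r [per sum ler]] := H i; exists r; split=> //.
  by move=> t let1; have := per (t - t0); rewrite /held addnA subnKC; [apply|]; lia.
by rewrite -sum; apply: eq_bigr => t _; rewrite /held addnA.
Qed.
End Eventually.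

Lemma free_or_laps_positions :
  (exists t0, forall t i, ~~ (R (t0 + t) i || L (t0 + t) i)) \/
  eventually_laps N m l (fun t i => R t i || L t i).
Proof.
have [t0 H] := exact_eventually.
by have [|] := @free_or_laps_eventually t0 (fun t i => @H t i); [left; exists t0 | right].
Qed.
End Exact.

Lemma free_or_laps N m l (x : state N m) : 0 < m -> 0 < l <= m ->
  results_in l (@free_movement N m l) x \/
  eventually_laps N m l (fun t i => delayed l (trajectory l x t) i).
Proof.
move=> m_gt0 /andP[l_gt0 l_le_m].
pose y t i : nat := trajectory l x t i.
have dE t i : delayed l (trajectory l x t) i =
    held_right m l (y t i) (y t (ordS i)) || held_left m l (y t (ord_pred i)) (y t i).
  rewrite delayedE /held_right /held_left -/(y t i) -/(y t (ordS i)).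
    by congr (_ && _ || _); lia.
  by rewrite l_gt0; lia.
have [||[t0 H]|[t0 H]] := @free_or_laps_positions N m l m_gt0 l_gt0 l_le_m y.
- by move=> t i; exact: ltn_ord.
- by move=> t i; rewrite -dE; exact: step_advance.
- by left; exists t0 => t i; rewrite trajectoryD dE.
right; exists t0 => i; have [r [per sum ler]] := H i; exists r; split=> // [t let0|].
  by rewrite !dE per.
by rewrite -sum; apply: eq_bigr => t _; rewrite dE.
Qed.

(** * Average velocities of eventually periodic motions *)

Lemma bounded_from_periodic (R : realType) (e : nat -> R) t0 P : 0 < P ->
  (forall t, t0 <= t -> e (t + P) = e t) ->
  exists C : R, forall t, (`|e t| <= C)%R.
Proof.
move=> P_gt0 per; exists (\sum_(k < t0 + P) `|e k|)%R => t.
have [n] := ubnP t; elim: n t => // n IH t ltn.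
have [lt|ge] := ltnP t (t0 + P).
  rewrite (bigD1 (Ordinal lt)) //= lerDl; apply: sumr_ge0 => k _; exact: normr_ge0.
have -> : e t = e (t - P) by rewrite -[in LHS](@subnK P t) ?per //; lia.
by apply: IH; lia.
Qed.

Lemma moves_periodic N m l (x : state N m) i t0 P K t :
  (forall t, t0 <= t ->
     delayed l (trajectory l x (t + P)) i = delayed l (trajectory l x t) i) ->
  \sum_(t < P) ~~ delayed l (trajectory l x (t0 + t)) i = K ->
  t0 <= t -> moves l x i (t + P) = moves l x i t + K.
Proof.
move=> per sum /subnKC <-; elim: (t - t0) => [|n IH].
  by rewrite addn0 /moves big_split_ord /= sum.
rewrite addnS addSn /moves !big_ord_recr /= -!/(moves l x i _) IH per ?leq_addr //.
by rewrite addnAC.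
Qed.

Lemma average_velocity_periodic (R : realType) N m l (x : state N m) i t0 P K :
  0 < P ->
  (forall t, t0 <= t ->
     delayed l (trajectory l x (t + P)) i = delayed l (trajectory l x t) i) ->
  \sum_(t < P) ~~ delayed l (trajectory l x (t0 + t)) i = K ->
  average_velocity l x i (K%:R / P%:R : R)%R.
Proof.
move=> P_gt0 per sum.
(* This is [P * t] times the difference between the mean velocity up to [t] and [K / P]. It is
   eventually periodic, hence bounded. *)
pose e t : R := (P%:R * (moves l x i t)%:R - t%:R * K%:R)%R.
have [|C HC] := @bounded_from_periodic R e t0 P P_gt0.
  move=> t let0; rewrite /e (moves_periodic per sum let0) !natrD mulrDr mulrDl.
  by rewrite opprD addrACA subrr addr0.
have P0 : (0 < P%:R :> R)%R by rewrite ltr0n.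
apply/cvgrPdist_le => eps eps0; near=> t.
have t0' : (0 < t%:R :> R)%R by rewrite ltr0n; near: t; exists 1.
have -> : (K%:R / P%:R - (moves l x i t)%:R / t%:R = - (e t / (P%:R * t%:R)) :> R)%R.
  by rewrite /e; field; rewrite !gt_eqF.
rewrite normrN normrM normfV (gtr0_norm (mulr_gt0 P0 t0')) ler_pdivrMr ?mulr_gt0 //.
apply: le_trans (HC t) _; rewrite mulrCA -ler_pdivrMl //.
rewrite mulrC -ler_pdivrMl // mulrC; near: t; exact: nbhs_infty_ger.
Unshelve. all: by end_near.
Qed.

Lemma average_velocity_unique (R : realType) N m l (x : state N m) i (v w : R) :
  average_velocity l x i v -> average_velocity l x i w -> v = w.
Proof. exact: cvg_unique. Qed.

Lemma orbit_limit_cycle N m l (x : state N m) p : 0 < p -> admissible l x ->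
  trajectory l x p = x -> limit_cycle l (fingraph.orbit (step l) x).
Proof.
case: p => // p _ adm per; split.
- by apply/eqP => E; have := in_orbit (step l) x; rewrite E.
- rewrite /ucycle orbit_uniq andbT; apply/(orbitPcycle 0 3); by exists p.
by exists x => //; exists 0; exact: in_orbit.
Qed.

Lemma orbit_trajectory N m l (x y : state N m) :
  y \in fingraph.orbit (step l) x -> exists s, y = trajectory l x s.
Proof. by case/trajectP => s _ ->; exists s. Qed.

(** * Free movement with all clusters in equal cells *)

Section Uniform.
Variables (N m l : nat).
Hypotheses (m_gt0 : 0 < m) (l_le_m : l <= m) (l_gt0 : 0 < l).

Definition uniform_state (a : 'I_(2 * m)) : state N m := [ffun=> a].

Lemma uniform_free a i : delayed l (uniform_state a) i = false.
Proof.
by rewrite delayedE ?ffunE; [|lia]; move: (nat_of_ord a) => b; lia.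
Qed.

Lemma uniform_trajectory a t :
  trajectory l (uniform_state a) t = uniform_state (iter t (@ordS _) a).
Proof.
elim: t => //= t ->; apply/ffunP => i.
by rewrite ffunE uniform_free !ffunE.
Qed.

Lemma uniform_limit_velocity (R : realType) : limit_velocity N m l (1%R : R).
Proof.
have a0 : 'I_(2 * m) by apply: (@Ordinal _ 0); lia.
exists (fingraph.orbit (step l) (uniform_state a0)).
  apply: (@orbit_limit_cycle _ _ _ _ (2 * m)); first by lia.
    apply/forallP => i; rewrite !ffunE /occupies_right occupies_leftE; last lia.
    move: (nat_of_ord a0) => b; lia.
  by rewrite uniform_trajectory iter_ordS.
move=> _ /orbit_trajectory[s ->] i.
have -> : (1 = 1%:R / 1%:R :> R)%R by rewrite divr1.
apply: (@average_velocity_periodic _ _ _ _ _ _ 0) => //.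
  by move=> t _; rewrite !trajectoryD !uniform_trajectory !uniform_free.
by rewrite big_ord1 trajectoryD uniform_trajectory uniform_free.
Qed.
End Uniform.

(** * Travelling waves on the whole chain *)

Section WaveState.
Variables (N m l r : nat).
Hypotheses (N_gt0 : 0 < N) (m_gt0 : 0 < m) (l_gt0 : 0 < l) (l_le_m : l <= m).
Hypothesis (r_gt0 : 0 < r).

Let P := N * (m + l).
Hypotheses (P_gt : 2 * m * r < P) (P_le : P <= r * (2 * m + l)).

(** The clock of contour [i]: contour [i - 1] is [m + l] steps ahead, and [N - i] keeps the offset a
    natural number. *)
Let arg t (i : 'I_N) := r * (t + (N - i) * (m + l)).

Definition wave_state (t : nat) : state N m :=
  [ffun i => Ordinal (wave_cell_lt P r (arg t i) m_gt0)].

Let waveE t i : wave_state t i = wave_cell m P r (arg t i) :> nat.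
Proof. by rewrite ffunE. Qed.

Let argS t i : arg t.+1 i = arg t i + r.
Proof. by rewrite /arg addSn mulnS addnC. Qed.

Let wave_pred t i :
  wave_state t (ord_pred i) = wave_cell m P r (arg t i + r * (m + l)) :> nat.
Proof.
rewrite waveE; have [i0|i_gt0] := posnP i.
  (* At the seam between contours 0 and [N - 1] the clocks differ from the rule by [r] full periods,
     which do not change the cell. *)
  have -> : arg t i + r * (m + l) = arg t (ord_pred i) + r * P; last first.
    by rewrite (wave_cellDP P_gt).
  rewrite /arg /= i0 add0n subn0 modn_small; last lia.
  by rewrite /P; have -> : N - N.-1 = 1 by [lia]; lia.
have -> : arg t i + r * (m + l) = r * (t + (N - i).+1 * (m + l)).
  by rewrite /arg mulSn -mulnDr -addnA [(N - i) * _ + _]addnC.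
have := ltn_ord i; rewrite /arg /= => ltN.
have -> : (i + N).-1 %% N = i.-1.
  have -> : (i + N).-1 = i.-1 + N by lia.
  by rewrite modnDr modn_small //; lia.
by have -> : N - i.-1 = (N - i).+1 by lia.
Qed.

Let wave_succ t i : (wave_state t i < l) && (m < wave_state t (ordS i) < m + l) = false.
Proof.
have -> : wave_state t i = wave_state t (ord_pred (ordS i)) by rewrite ordSK.
by rewrite wave_pred waveE (wave_unoccupied m_gt0 l_gt0 l_le_m r_gt0 P_gt P_le).
Qed.

Lemma wave_delayed t i : delayed l (wave_state t) i = (2 * m * r <= arg t i %% P).
Proof.
rewrite -(wave_held m_gt0 l_gt0 l_le_m r_gt0 P_gt P_le) delayedE; last lia.
rewrite -waveE -wave_pred; have := wave_succ t i; move: (nat_of_ord _) => a.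
by move: (nat_of_ord _) (nat_of_ord _) => b c; lia.
Qed.

Lemma wave_step t : step l (wave_state t) = wave_state t.+1.
Proof.
apply/ffunP => i; apply: val_inj; rewrite /= step_advance wave_delayed !waveE argS.
by rewrite (wave_cellS m_gt0 l_gt0 l_le_m r_gt0 P_gt P_le).
Qed.

Lemma wave_trajectory s t : trajectory l (wave_state s) t = wave_state (s + t).
Proof. by elim: t => [|t IH]; rewrite ?addn0 //= IH wave_step addnS. Qed.

Lemma wave_stateDP t : wave_state (t + P) = wave_state t.
Proof.
apply/ffunP => i; apply: val_inj; rewrite /= !waveE -[RHS](wave_cellDP P_gt _ r).
by congr wave_cell; rewrite /arg addnAC mulnDr.
Qed.

Lemma wave_admissible t : admissible l (wave_state t).
Proof.
apply/forallP => i; rewrite occupies_leftE /occupies_right; last lia.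
have := wave_succ t i; move: (nat_of_ord (wave_state t i)) => a.
by move: (nat_of_ord (wave_state t (ordS i))) => b; lia.
Qed.

Lemma wave_moves s i : \sum_(t < P) ~~ delayed l (wave_state (s + t)) i = 2 * m * r.
Proof.
have H n : wave_lift m P r (arg (s + n) i) =
    wave_lift m P r (arg s i) + \sum_(t < n) ~~ delayed l (wave_state (s + t)) i.
  elim: n => [|n IH]; first by rewrite big_ord0 !addn0.
  rewrite big_ord_recr /= addnS argS (wave_liftS m_gt0 l_gt0 l_le_m r_gt0 P_gt P_le) IH.
  by rewrite wave_delayed -ltnNge addnA.
(* In [P] steps the clock runs through [r] full periods, one lap each. *)
have := H P; have -> : arg (s + P) i = arg s i + r * P by rewrite /arg addnAC mulnDr.
by rewrite (wave_liftDP P_gt); lia.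
Qed.

Lemma wave_limit_velocity (R : realType) :
  limit_velocity N m l (velocity_value R N m l r).
Proof.
have P_gt0 : 0 < P by lia.
exists (fingraph.orbit (step l) (wave_state 0)).
  apply: (orbit_limit_cycle P_gt0 (wave_admissible 0)).
  by rewrite wave_trajectory wave_stateDP.
move=> _ /orbit_trajectory[s ->] i.
apply: (@average_velocity_periodic _ _ _ _ _ _ 0) => //.
  by move=> t _; rewrite trajectoryD !wave_trajectory addnA addnA wave_stateDP.
rewrite -(wave_moves s i); apply: eq_bigr => t _.
by rewrite !wave_trajectory.
Qed.
End WaveState.

(** * Lap counts and the possible velocities *)

Lemma sum_minn_sub l K r : \sum_(j < r) minn l (K - j * l) = minn K (r * l).
Proof.
elim: r => [|r IH]; first by rewrite big_ord0 minn0.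
by rewrite big_ord_recr /= IH mulSn; lia.
Qed.

Lemma bounded_summands m l r P : 2 * m * r <= P ->
  (P <= r * (2 * m + l) <->
   exists k : 'I_r -> nat,
     (forall j, k j <= l) /\ P = 2 * m * r + \sum_(j < r) k j).
Proof.
move=> lo; split=> [hi|[k [kl ->]]].
  (* Greedy choice: each summand takes up to [l] from what remains of [P - 2 * m * r]. *)
  exists (fun j : 'I_r => minn l (P - 2 * m * r - j * l)).
  by split=> [j|]; [exact: geq_minl | rewrite sum_minn_sub; lia].
rewrite mulnDr [r * _]mulnC leq_add2l.
have -> : r * l = \sum_(j < r) l by rewrite sum_nat_const card_ord.
by apply: leq_sum => j _; exact: kl.
Qed.

Lemma free_velocity (R : realType) N m l (x : state N m) i :
  results_in l (@free_movement N m l) x -> average_velocity l x i (1%R : R).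
Proof.
move=> [t0 free].
have H t : t0 <= t -> delayed l (trajectory l x t) i = false.
  by move=> /subnKC <-; rewrite -trajectoryD; apply/negbTE/free.
have -> : (1 = 1%:R / 1%:R :> R)%R by rewrite divr1.
apply: (@average_velocity_periodic _ _ _ _ _ _ t0) => // [t let0|].
  by rewrite !H // (leq_trans let0) // leq_addr.
by rewrite big_ord1 H ?addn0.
Qed.

(** A delay after [t0] recurs in the window of the lap count, so [2 * m * r] is below the period; by
    hypothesis the [r] laps then cannot fill it. *)
Lemma small_free (N m l : nat) (x : state N m) : 0 < N -> 0 < m -> 0 < l <= m ->
  (forall r, 2 * m * r < N * (m + l) -> r * (2 * m + l) < N * (m + l)) ->
  results_in l (@free_movement N m l) x.
Proof.
move=> N_gt0 m_gt0 lm small; have [//|[t0 laps]] := free_or_laps x m_gt0 lm.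
exists t0 => t i; rewrite trajectoryD; apply/negP => held_t.
have [r [per sum]] := laps i.
set P := N * (m + l) in sum per small *.
have P_gt0 : 0 < P by rewrite /P muln_gt0; lia.
rewrite leqNgt small // -/P -sum.
have lt_P := ltn_pmod t P_gt0.
have held_mod : delayed l (trajectory l x (t0 + t %% P)) i.
  rewrite (divn_eq t P) [_ * P + _]addnC in held_t.
  elim: (t %/ P) held_t => [|k IH]; first by rewrite mul0n addn0.
  by rewrite mulSn [P + _]addnC !addnA per -addnA // leq_addr.
rewrite (bigD1 (Ordinal lt_P)) //= held_mod add0n.
apply: (@leq_ltn_trans (\sum_(k < P | k != Ordinal lt_P) 1)).
  by apply: leq_sum => k _; case: (delayed _ _ _).
by rewrite sum1_card cardC1 card_ord; lia.
Qed.

(** Free movement would give velocity 1, so the laps of the dichotomy determine [v]. The two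
    resulting bounds on [r] are exactly those under which a wave exists. *)
Lemma slow_velocity (R : realType) N m l (v : R) : 0 < N -> 0 < m -> 0 < l <= m ->
  (v < 1)%R -> limit_velocity N m l v ->
  exists r, [/\ v = velocity_value R N m l r, 2 * m * r < N * (m + l)
              & N * (m + l) <= r * (2 * m + l)].
Proof.
move=> N_gt0 m_gt0 lm v_lt1 [c [c0 _ _] vc].
have [x xc] : exists x, x \in c.
  by case: c c0 {vc} => // x c _; exists x; rewrite mem_head.
pose i := Ordinal N_gt0; have vx := vc x xc i.
have [free|[t0 laps]] := free_or_laps x m_gt0 lm.
  have := average_velocity_unique vx (free_velocity i free).
  by move=> v1; rewrite v1 ltxx in v_lt1.
have [r [per sum ler]] := laps i.
have P_gt0 : 0 < N * (m + l) by rewrite muln_gt0; lia.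
have vE : v = velocity_value R N m l r.
  exact: (average_velocity_unique vx (average_velocity_periodic P_gt0 per sum)).
exists r; split=> //; move: v_lt1.
by rewrite vE /velocity_value ltr_pdivrMr ?ltr0n // mul1r ltr_nat.
Qed.

Lemma velocity_value_lt1 (R : realType) N m l r : 0 < N -> 0 < m ->
  (velocity_value R N m l r < 1)%R = (2 * m * r < N * (m + l)).
Proof.
move=> N_gt0 m_gt0; rewrite /velocity_value ltr_pdivrMr ?mul1r ?ltr_nat //.
by rewrite ltr0n muln_gt0; lia.
Qed.

Lemma velocity_value_inj (R : realType) N m l : 0 < N -> 0 < m ->
  injective (velocity_value R N m l).
Proof.
move=> N_gt0 m_gt0 r s; rewrite /velocity_value.
have P0 : ((N * (m + l))%N%:R != 0 :> R)%R by rewrite pnatr_eq0; nia.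
move=> /(divIf P0)/eqP; rewrite eqr_nat; nia.
Qed.

(** Since [2 * m + l <= 3 * m], motion takes at least two thirds of even the longest lap. *)
Lemma velocity_value_ge (R : realType) N m l r : 0 < N -> 0 < m -> l <= m ->
  N * (m + l) <= r * (2 * m + l) -> (2%:R / 3%:R <= velocity_value R N m l r)%R.
Proof.
move=> N_gt0 m_gt0 lm H; rewrite /velocity_value ler_pdivlMr; last first.
  by rewrite ltr0n muln_gt0; lia.
rewrite mulrAC ler_pdivrMr ?ltr0n // -!natrM ler_nat; nia.
Qed.

Lemma slow_velocities_count (R : realType) N m l : 0 < N -> 0 < m -> 0 < l <= m ->
  ([set v : R | (v < 1)%R /\ limit_velocity N m l v]%classic
     #<= (`I_(N %/ 3)%N)%classic)%card.
Proof.
move=> N_gt0 m_gt0 lm.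
(* The quotient of [N * (m + l)] by [2 * m + l] rounded up, which is the least possible lap
   count. *)
pose s := N * (m + l) %/ (2 * m + l) + (~~ (2 * m + l %| N * (m + l))).
have d_gt0 : 0 < 2 * m + l by lia.
have sP r : N * (m + l) <= r * (2 * m + l) -> s <= r.
  move=> H; rewrite /s; have := divn_eq (N * (m + l)) (2 * m + l).
  rewrite /dvdn; case: eqP; nia.
have sge : N * (m + l) <= s * (2 * m + l).
  rewrite /s; have := divn_eq (N * (m + l)) (2 * m + l).
  have := ltn_pmod (N * (m + l)) d_gt0; rewrite /dvdn; case: eqP; nia.
apply: card_le_trans (card_image_le (fun k => velocity_value R N m l (s + k)) _).
apply: subset_card_le => v [v_lt1 /(slow_velocity N_gt0 m_gt0 lm v_lt1)[r [vE lo hi]]].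
exists (r - s); last by rewrite subnKC ?sP.
have := laps_count m_gt0 (andP lm).2 lo sge (sP r hi).
by rewrite /= leq_divRL; lia.
Qed.

Lemma ler_nat_ratio (R : realType) a b c : 0 < c ->
  ((a%:R : R) <= b%:R / c%:R)%R = (c * a <= b).
Proof. by move=> c_gt0; rewrite ler_pdivlMr ?ltr0n // -natrM ler_nat mulnC. Qed.

Lemma small_cluster_free (R : realType) N m l (x : state N m) :
  parameters N m l -> small_cluster R N m l ->
  results_in l (@free_movement N m l) x.
Proof.
case=> N2 m1 /andP[l1 l2]; have N_gt0 : 0 < N by lia.
case=> -[oddN]; rewrite ler_nat_ratio // => Nl.
  have lm : l <= m by nia.
  by apply: small_free => //; [rewrite l1 | move=> r; exact: small_odd_laps].
have lm : l <= m by nia.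
by apply: small_free => //; [rewrite l1 | move=> r; exact: small_even_laps].
Qed.

Lemma limit_velocityP (R : realType) N m l r : 0 < N -> 0 < m -> 0 < l <= m ->
  velocity_range (velocity_value R N m l r) ->
  limit_velocity N m l (velocity_value R N m l r) <->
  exists k : 'I_r -> nat,
    (forall j, k j <= l) /\ (m + l) * N = 2 * m * r + \sum_(j < r) k j.
Proof.
move=> N_gt0 m_gt0 lm /andP[ge23 lt1].
have lo := lt1; rewrite velocity_value_lt1 // in lo.
have r_gt0 : 0 < r.
  rewrite lt0n; apply/eqP => r0; move: ge23.
  by rewrite r0 /velocity_value muln0 mul0r leNgt divr_gt0 ?ltr0n.
rewrite [(m + l) * N]mulnC -(bounded_summands l (ltnW lo)); split=> [lim|hi].
  have [s [/velocity_value_inj-> //]] := slow_velocity N_gt0 m_gt0 lm lt1 lim.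
by apply: wave_limit_velocity => //; case/andP: lm.
Qed.

Theorem theorem12 (R : realType) :
  (forall N m l : nat, parameters N m l ->
    [/\ small_cluster R N m l ->
          forall x : state N m, admissible l x ->
            results_in l (free_movement l) x,
        medium_cluster R N m l ->
          [/\ limit_velocity N m l (1%R : R),
              ([set v : R | (v < 1)%R /\ limit_velocity N m l v]%classic
                 #<= (`I_(N %/ 3)%N)%classic)%card,
              forall v : R, (v < 1)%R -> limit_velocity N m l v ->
                exists2 r : nat,
                  v = velocity_value R N m l r & velocity_range v
            & forall r : nat, velocity_range (velocity_value R N m l r) ->
                (limit_velocity N m l (velocity_value R N m l r) <->
                 exists k : 'I_r -> nat,
                   (forall j, k j <= l) /\
                   (m + l) * N = 2 * m * r + \sum_(j < r) k j)]
      & m < l ->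
          forall x : state N m, admissible l x ->
            results_in l (collapse l) x])
  /\
  (exists N m l : nat,
    [/\ parameters N m l, medium_cluster R N m l
      & exists2 v : R, (v < 1)%R & limit_velocity N m l v]).
Proof.
split=> [N m l par|].
  have [N2 m_gt0 /andP[l_gt0 l_lt]] := par; have N_gt0 : 0 < N by lia.
  split=> [small x _|med|m_lt_l x].
  - exact: small_cluster_free small.
  - have l_le_m : l <= m.
      by case: med => -[_ /andP[_]]; rewrite ler_nat.
    have lm : 0 < l <= m by rewrite l_gt0.
    split.
    + exact: uniform_limit_velocity.
    + exact: slow_velocities_count.
    + move=> v v_lt1 lim.
      have [r [vE lo hi]] := slow_velocity N_gt0 m_gt0 lm v_lt1 lim.
      by exists r; rewrite // /velocity_range v_lt1 vE velocity_value_ge.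
    + by move=> r; exact: limit_velocityP.
  - exact: collapse_eventually.
exists 3, 1, 1; split=> //.
  left; split=> //; rewrite lexx andbT.
  by rewrite ltNge ler_nat_ratio.
(* With two laps per period 6 the wave bounds read [4 < 6 <= 6], and the velocity is 2/3. *)
exists (velocity_value R 3 1 1 2); first by rewrite velocity_value_lt1.
exact: wave_limit_velocity.
Qed.
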